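(* Let $d=2^n$ with $n\ge1$ and let $A,B,C,D$ be linear operators on $\mathbb{C}^d$. Then $$\langle A\tilde BC\tilde D\rangle_{\mathrm{Haar}}=\langle AC\rangle\langle B\rangle\langle D\rangle+\langle A\rangle\langle C\rangle\langle BD\rangle-\langle A\rangle\langle C\rangle\langle B\rangle\langle D\rangle-\frac{1}{d^2-1}\langle\!\langle AC\rangle\!\rangle\,\langle\!\langle BD\rangle\!\rangle .$$
   Context: For an operator $O$ on $\mathbb{C}^d$, $\langle O\rangle=\frac1d\mathrm{tr}\{O\}$, and $\langle\!\langle AC\rangle\!\rangle=\langle AC\rangle-\langle A\rangle\langle C\rangle$ is the connected correlator. The Haar-averaged four-point out-of-time-order correlator is $\langle A\tilde BC\tilde D\rangle_{\mathrm{Haar}}=\int_{\mathrm{Haar}}dU\,\frac1d\mathrm{tr}\{A\,U^\dagger BU\,C\,U^\dagger DU\}$, with $dU$ the Haar probability measure on the unitary group $U(d)$. *)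

(* Defs.v *)
From HB Require Import structures.
From mathcomp Require Import all_boot all_order all_algebra.
From mathcomp Require Import complex.
From mathcomp Require Import all_classical all_reals all_analysis.

Set Implicit Arguments.
Unset Strict Implicit.
Unset Printing Implicit Defensive.

Import Order.TTheory GRing.Theory Num.Theory.
Import numFieldNormedType.Exports.
Local Open Scope classical_set_scope.
Local Open Scope ring_scope.
Local Open Scope complex_scope.
Local Open Scope sesquilinear_scope.

Record unitary (R : realType) (d : nat) := Unitary {
  unitary_mx :> 'M[R[i]]_d;
  unitary_mxP : unitary_mx \is unitarymx }.

HB.instance Definition _ (R : realType) (d : nat) :=
  [isSub for @unitary_mx R d].
HB.instance Definition _ (R : realType) (d : nat) :=
  [Choice of unitary R d by <:].

Lemma unitary1_subproof (R : realType) (d : nat) :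
  (1%:M : 'M[R[i]]_d) \is unitarymx.
Proof. by apply/unitarymxP; rewrite trmx1 map_mx1 mulmx1. Qed.

Definition unitary1 (R : realType) (d : nat) : unitary R d :=
  Unitary (unitary1_subproof R d).

Definition unitary_mul (R : realType) (d : nat) (U V : unitary R d) :
    unitary R d :=
  Unitary (mul_unitarymx (unitary_mxP U) (unitary_mxP V)).

Lemma unitaryV_subproof (R : realType) (d : nat) (U : unitary R d) :
  (unitary_mx U)^t* \is unitarymx.
Proof. by rewrite trmxC_unitary unitary_mxP. Qed.

Definition unitary_inv (R : realType) (d : nat) (U : unitary R d) :
    unitary R d :=
  Unitary (unitaryV_subproof U).

Lemma unitary_mulA (R : realType) (d : nat) : associative (@unitary_mul R d).
Proof. by move=> U V W; apply: val_inj; rewrite /= mulmxA. Qed.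

Lemma unitary_mul1 (R : realType) (d : nat) :
  left_id (unitary1 R d) (@unitary_mul R d).
Proof. by move=> U; apply: val_inj; rewrite /= mul1mx. Qed.

Lemma unitary_mulV (R : realType) (d : nat) :
  left_inverse (unitary1 R d) (@unitary_inv R d) (@unitary_mul R d).
Proof.
move=> U; apply: val_inj => /=.
by apply: mulmx1C; apply/unitarymxP; exact: unitary_mxP.
Qed.

Lemma unitary_mulr1 (R : realType) (d : nat) :
  right_id (unitary1 R d) (@unitary_mul R d).
Proof. by move=> U; apply: val_inj; rewrite /= mulmx1. Qed.

Lemma unitary_mulrV (R : realType) (d : nat) :
  right_inverse (unitary1 R d) (@unitary_inv R d) (@unitary_mul R d).
Proof.
by move=> U; apply: val_inj; apply/unitarymxP; exact: unitary_mxP.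
Qed.

HB.instance Definition _ (R : realType) (d : nat) :=
  isGroup.Build (unitary R d) (@unitary_mulA R d) (@unitary_mul1 R d)
    (@unitary_mulr1 R d) (@unitary_mulV R d) (@unitary_mulrV R d).
HB.instance Definition _ (R : realType) (d : nat) :=
  isPointed.Build (unitary R d) 1%g.
(* The subspace topology of U(d); the topology of R[i] is the one given by its
   norm, which the library attaches to R[i]^o. *)
HB.instance Definition _ (R : realType) (d : nat) :=
  Topological.copy (unitary R d)
    (initial_topology (fun U : unitary R d => U : 'M[R[i]^o]_d)).

Definition unitary_borel (R : realType) (d : nat) :=
  g_sigma_algebraType (@open (unitary R d)).

(* Left invariance is the defining property; on the compact group U(d),
   a left-invariant Borel probability measure exists, is unique and is also
   right-invariant. *)
Definition is_haar (R : realType) (d : nat)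
    (mu : probability (unitary_borel R d) R) : Prop :=
  forall (V : unitary R d) (S : set (unitary_borel R d)), measurable S ->
    mu [set U : unitary R d | S (V * U)%g] = mu S.

Definition complex_integral (disp : measure_display)
    (T : measurableType disp) (R : realType)
    (mu : {measure set T -> \bar R}) (f : T -> R[i]) : R[i] :=
  (\int[mu]_x complex.Re (f x)) +i* (\int[mu]_x complex.Im (f x)).

Definition mean (R : realType) (d : nat) (O : 'M[R[i]]_d) : R[i] :=
  d%:R^-1 * \tr O.

Definition connected_corr (R : realType) (d : nat) (A C : 'M[R[i]]_d) : R[i] :=
  mean (A *m C) - mean A * mean C.

(* The integrand is continuous, hence bounded, on the compact group U(d). *)
Definition otoc_haar (R : realType) (d : nat)
    (mu : probability (unitary_borel R d) R) (A B C D : 'M[R[i]]_d) : R[i] :=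
  complex_integral mu (fun U : unitary R d =>
    d%:R^-1 * \tr (A *m (U^t* *m B *m U) *m C *m (U^t* *m D *m U))).

(* Main.v *)
From HB Require Import structures.
Require Import Defs.
From mathcomp Require Import all_boot all_order all_algebra all_fingroup.
From mathcomp Require Import complex.
From mathcomp Require Import all_classical all_reals all_analysis.
From mathcomp Require Import measurable_realfun ring.

(** For fixed A and C,
    f(B, D) = E tr(A U*BU C U*DU) is bilinear in (B, D), and left translation
    of U by V shows that it is invariant under simultaneous conjugation of B
    and D by V. Such a form is a tr(B) tr(D) + b tr(BD): invariance under
    diagonal phases kills all but the coefficients f(E_ii, E_kk) and
    f(E_ik, E_ki), permutations make them independent of the indices, and one
    unitary mixing two basis vectors relates the coefficient with i = k to the
    other two. The constants follow from f(1, 1) = tr(AC), i.e.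
    a d^2 + b d = tr(AC), and from the pointwise identity
    sum_ij f(E_ij, E_ji) = tr(A) tr(C), i.e. a d + b d^2 = tr(A) tr(C). *)

Set Implicit Arguments.
Unset Strict Implicit.
Unset Printing Implicit Defensive.

Import Order.TTheory GRing.Theory Num.Theory.
Import numFieldNormedType.Exports.
Local Open Scope ring_scope.
Local Open Scope sesquilinear_scope.

(** * Matrix units and bilinear forms on matrices *)

Lemma mxtrace_delta (K : pzRingType) d (i j : 'I_d) :
  \tr (delta_mx i j : 'M[K]_d) = (i == j)%:R.
Proof.
rewrite /mxtrace (bigD1 i) //= big1 ?addr0; first by rewrite mxE eqxx.
by move=> k /negPf ki; rewrite mxE ki.
Qed.

Lemma delta_mul_delta (K : comPzRingType) d (X : 'M[K]_d) (i j k l : 'I_d) :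
  delta_mx i j *m X *m delta_mx k l = X j k *: delta_mx i l.
Proof.
(* Each unit is a column times a row, factored through dimension 1; what remains in the middle is a
   1 x 1 matrix, hence a scalar. *)
transitivity (delta_mx i (0 : 'I_1) *m (row j X *m delta_mx k (0 : 'I_1))
              *m delta_mx (0 : 'I_1) l).
  by rewrite rowE !mulmxA mul_delta_mx -!mulmxA mul_delta_mx.
rewrite -colE [col k _]mx11_scalar mul_mx_scalar -scalemxAl mul_delta_mx.
by rewrite !mxE.
Qed.

(** Each summand collapses to [X j j *: delta_mx i i]. With [X] a conjugate of [C], this evaluates
    the form summed over the pairs E_ij, E_ji. *)
Lemma sum_delta_mul_delta (K : comPzRingType) d (X : 'M[K]_d) :
  \sum_(i < d) \sum_(j < d) delta_mx i j *m X *m delta_mx j i = (\tr X)%:M.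
Proof.
rewrite scalar_mx_sum_delta; apply: eq_bigr => i _.
by rewrite scaler_suml; apply: eq_bigr => j _; rewrite delta_mul_delta.
Qed.

Lemma scalar_sum (K : comPzRingType) (V : lmodType K) (g : V -> K)
    (I : Type) (r : seq I) (P : pred I) (a : I -> K) (v : I -> V) :
  scalar g -> g (\sum_(i <- r | P i) a i *: v i) = \sum_(i <- r | P i) a i * g (v i).
Proof.
move=> gl; have g0 : g 0 = 0 by have := gl (-1) 0 0; rewrite scaler0 addr0 mulN1r addNr.
elim/big_rec2: _ => [|i y x _ IH]; first exact: g0.
by rewrite gl IH.
Qed.

Lemma eq_bilinear_delta (K : comPzRingType) d (f g : 'M[K]_d -> 'M[K]_d -> K) :
    (forall D, scalar (f^~ D)) -> (forall B, scalar (f B)) ->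
    (forall D, scalar (g^~ D)) -> (forall B, scalar (g B)) ->
    (forall i j k l, f (delta_mx i j) (delta_mx k l) =
                     g (delta_mx i j) (delta_mx k l)) ->
  f =2 g.
Proof.
move=> fl fr gl gr fg B D.
rewrite [B]matrix_sum_delta [D]matrix_sum_delta !pair_bigA /=.
rewrite (scalar_sum _ _ _ _ (fl _)) (scalar_sum _ _ _ _ (gl _)).
apply: eq_bigr => x _; congr (_ * _).
rewrite (scalar_sum _ _ _ _ (fr _)) (scalar_sum _ _ _ _ (gr _)).
by apply: eq_bigr => y _; rewrite fg.
Qed.

(** * Unitarily invariant bilinear forms on matrices *)

Section InvariantForm.
Context (C : numClosedFieldType).

(** A matrix unit has rank one, so its conjugate is the conjugated row [i] of [V], as a column,
    times row [j] of [V]. *)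
Lemma conj_delta_mxE d (V : 'M[C]_d) i j x y :
  (V^t* *m delta_mx i j *m V) x y = (V i x)^* * V j y.
Proof.
rewrite -(mul_delta_mx (0 : 'I_1)) mulmxA -mulmxA -colE -rowE mxE big_ord1.
by rewrite !mxE.
Qed.

Lemma conjCi_mul : ('i : C)^* * 'i = 1.
Proof. by rewrite conjCi mulNr -expr2 sqrCi opprK. Qed.

Lemma N1_neq1 : -1 != 1 :> C.
Proof. by rewrite eq_sym -subr_eq0 opprK -mulr2n pnatr_eq0. Qed.

Lemma NCi_neq1 : - 'i != 1 :> C.
Proof.
apply/eqP => i1; have := @sqrCi C; rewrite -sqrrN i1 expr1n => /eqP.
by rewrite eq_sym (negPf N1_neq1).
Qed.

Lemma diag_unitary d (v : 'rV[C]_d) :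
  (forall i, (v 0 i)^* * v 0 i = 1) -> diag_mx v \is unitarymx.
Proof.
move=> v1; apply/unitarymxP/matrixP => i j; rewrite mul_diag_mx !mxE.
case: eqVneq => [->|ij]; first by rewrite ?eqxx ?mulr1n mulrC v1.
by rewrite mulr0n rmorph0 mulr0.
Qed.

Lemma perm_mx_unitary d (s : 'S_d) : (perm_mx s : 'M[C]_d) \is unitarymx.
Proof.
apply/unitarymxP; rewrite tr_perm_mx map_perm_mx -perm_mxM.
by rewrite mulgV perm_mx1.
Qed.

(** [E] is an orthogonal projection; the matrix acts as [z] on its range and as the identity on the
    orthogonal complement. *)
Lemma projector_unitary d (E : 'M[C]_d) (z : C) :
    z^* * z = 1 -> E^t* = E -> E *m E = E ->
  1%:M + (z - 1) *: E \is unitarymx.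
Proof.
move=> z1 Eh EE; apply/unitarymxP.
have -> : (1%:M + (z - 1) *: E)^t* = 1%:M + (z^* - 1) *: E.
  rewrite linearD linearZ /= trmx1 map_mxD map_mx1 map_mxZ Eh.
  by congr (_ + _ *: _); rewrite -[LHS]/((z - 1)^*) rmorphB rmorph1.
rewrite mulmxDl !mulmxDr !mul1mx mulmx1 -scalemxAl -scalemxAr EE scalerA.
rewrite -addrA -!scalerDl -[RHS]addr0; congr (_ + _).
rewrite [_ + _](_ : _ = 0) ?scale0r //.
transitivity (z^* * z - 1); first by ring.
by rewrite z1 subrr.
Qed.

(** Double transitivity of the symmetric group. The first transposition sends [p] to [i]; the second
    sends the image of [q] to [k] and fixes [i], which differs from both. *)
Lemma perm_pair d (p q i k : 'I_d) :
  p != q -> i != k -> exists s : 'S_d, s p = i /\ s q = k.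
Proof.
move=> pq ik; exists (tperm p i * tperm (tperm p i q) k)%g.
rewrite !permM tpermL; split; last by rewrite tpermL.
have ti : tperm p i q != i.
  by apply: contra_neq pq => tq; apply: (@perm_inj _ (tperm p i)); rewrite tpermL.
by apply: tpermD; rewrite // eq_sym.
Qed.

Lemma unitary_invariant_form d (f : 'M[C]_d -> 'M[C]_d -> C) :
    (1 < d)%N ->
    (forall D, scalar (f^~ D)) -> (forall B, scalar (f B)) ->
    (forall V, V \is unitarymx -> forall B D,
       f (V^t* *m B *m V) (V^t* *m D *m V) = f B D) ->
  exists a b, forall B D, f B D = a * (\tr B * \tr D) + b * \tr (B *m D).
Proof.
move=> d1 fl fr finv.
pose p := Ordinal (ltnW d1); pose q := Ordinal d1.
have pq : p != q by [].
pose T i j k l := f (delta_mx i j) (delta_mx k l).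
have fT i j k l : f (delta_mx i j) (delta_mx k l) = T i j k l by [].
have fZl a B D : f (a *: B) D = a * f B D.
  by have := fl D a B 0; rewrite addr0 => ->; have := fl D (-1) B B;
     rewrite scaleN1r addNr mulN1r addNr => ->; rewrite addr0.
have fDl B1 B2 D : f (B1 + B2) D = f B1 D + f B2 D.
  by have := fl D 1 B1 B2; rewrite scale1r mul1r.
have fZr a B D : f B (a *: D) = a * f B D.
  by have := fr B a D 0; rewrite addr0 => ->; have := fr B (-1) D D;
     rewrite scaleN1r addNr mulN1r addNr => ->; rewrite addr0.
have fDr B D1 D2 : f B (D1 + D2) = f B D1 + f B D2.
  by have := fr B 1 D1 D2; rewrite scale1r mul1r.
pose ph (m i : 'I_d) : C := if i == m then 'i else 1.
(* Invariance under the diagonal unitary with the single phase 'i at m. *)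
have phase m i j k l :
    (ph m i)^* * ph m j * ((ph m k)^* * ph m l) != 1 -> T i j k l = 0.
  move=> ph1; apply/eqP; move: ph1; apply: contraNT => T0.
  have U : diag_mx (\row_x ph m x) \is unitarymx.
    apply: diag_unitary => x; rewrite mxE /ph.
    by case: ifP; rewrite ?conjCi_mul // rmorph1 mulr1.
  have conjE x y : (diag_mx (\row_x ph m x))^t* *m delta_mx x y *m
      diag_mx (\row_x ph m x) = ((ph m x)^* * ph m y) *: delta_mx x y.
    apply/matrixP => u v; rewrite conj_delta_mxE !mxE.
    rewrite [x == u]eq_sym [y == v]eq_sym.
    by case: eqP => _; case: eqP => _;
       rewrite ?mulr1n ?mulr0n ?rmorph0 ?mulr0 ?mul0r ?mulr1.
  have := finv _ U (delta_mx i j) (delta_mx k l).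
  rewrite !conjE fZl fZr mulrA -/(T i j k l) => /eqP.
  by rewrite -[X in _ == X]mul1r (inj_eq (mulIf T0)).
have T_eq0 i j k l : ~~ ((i == j) && (k == l) || (i == l) && (j == k)) ->
    T i j k l = 0.
  (* The phase is put at an index that occurs more often conjugated than plain: at [k] if [i = j] or
     [i = l], where two of the other phases cancel, and at [i] otherwise. *)
  move=> H; case: (eqVneq i j) H => [<-{j}|ij]; rewrite /= ?andbT.
    rewrite negb_or => /andP[kl _]; apply: (phase k).
    rewrite /ph [l == k]eq_sym (negPf kl) eqxx mulr1.
    by case: ifP; rewrite ?conjCi_mul ?rmorph1 ?mulr1 mul1r conjCi NCi_neq1.
  case: (eqVneq i l) => [<-{l}|il] /=; rewrite ?andbT => H.
    apply: (phase k); rewrite /ph (negPf H) eqxx mulr1 conjCi.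
    case: ifP; rewrite ?rmorph1 ?mul1r ?mulr1 ?NCi_neq1 //.
    by rewrite mulNr -expr2 sqrCi opprK mulr1 conjCi NCi_neq1.
  (* Here [k = i] is possible: the conjugate phase then enters twice and gives -1. A sign -1 in
     place of ['i] would give 1 and prove nothing. *)
  apply: (phase i); rewrite /ph eqxx [j == i]eq_sym [l == i]eq_sym.
  rewrite (negPf ij) (negPf il) !mulr1 conjCi.
  case: ifP; rewrite ?rmorph1 ?mulr1 ?NCi_neq1 //.
  by rewrite conjCi mulrNN -expr2 sqrCi N1_neq1.
have T_perm (s : 'S_d) i j k l : T (s i) (s j) (s k) (s l) = T i j k l.
  rewrite /T -(finv _ (perm_mx_unitary s) (delta_mx i j)).
  have conjE x y : (perm_mx s)^t* *m delta_mx x y *m perm_mx s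
      = delta_mx (s x) (s y) :> 'M[C]_d.
    apply/matrixP => u v; rewrite conj_delta_mxE !mxE.
    by rewrite rmorph_nat -natrM mulnb [u == _]eq_sym [v == _]eq_sym.
  by rewrite !conjE.
have Ta i k : i != k -> T i i k k = T p p q q.
  by move=> /(perm_pair pq)[s [<- <-]]; rewrite T_perm.
have Tb i k : i != k -> T i k k i = T p q q p.
  by move=> /(perm_pair pq)[s [<- <-]]; rewrite T_perm.
have Tc i : T i i i i = T p p p p.
  by rewrite -{1 2 3 4}(tpermL p i) T_perm.
have Tabc : T p p p p = T p p q q + T p q q p.
  have two0 : (2 : C) != 0 by rewrite pnatr_eq0.
  (* E projects onto e_p + e_q; the unitary 1 + ('i - 1) E sends the diagonal
     unit at p to a matrix with entries on the whole {p, q} block, which ties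
     the three constants together. *)
  pose E : 'M[C]_d := 2^-1 *: (delta_mx p p + delta_mx p q
                               + (delta_mx q p + delta_mx q q)).
  have Eh : E^t* = E.
    apply/matrixP => x y; rewrite !mxE rmorphM /= fmorphV !rmorphD /= !rmorph_nat.
    by rewrite -!mulnb !natrM !rmorph1; ring.
  have EE : E *m E = E.
    rewrite /E -scalemxAl -scalemxAr scalerA.
    rewrite !mulmxDl !mulmxDr !mul_delta_mx_cond !eqxx (negPf pq).
    rewrite [q == p]eq_sym (negPf pq) !mulr0n !mulr1n.
    rewrite !addr0 !add0r addrACA -mulr2n -[(_ + _) *+ 2]scaler_nat scalerA.
    by rewrite mulfVK.
  have U := projector_unitary conjCi_mul Eh EE.
  set V := _ + _ in U.
  have VE : V^t* *m delta_mx p p *m V = 2^-1 *: (delta_mx p p + delta_mx q q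
     + ('i *: delta_mx p q + (- 'i) *: delta_mx q p)).
    have VpE x :
        V p x = (x == p)%:R + ('i - 1) * (2^-1 * ((x == p)%:R + (x == q)%:R)).
      by rewrite !mxE !eqxx (negPf pq) /= !addr0 [p == x]eq_sym.
    apply/matrixP => x y; rewrite conj_delta_mxE !VpE !mxE.
    rewrite !(rmorphD, rmorphM, rmorphB, rmorph_nat, fmorphV, rmorph1) /= conjCi.
    rewrite -!mulnb !natrM.
    set X := (x == p)%:R; set Xq := (x == q)%:R.
    set Y := (y == p)%:R; set Yq := (y == q)%:R.
    (* The subtracted multiple of ['i ^+ 2 + 1] vanishes; it makes the equation an identity with
       ['i] treated as an indeterminate, within reach of [field]. *)
    transitivity (2^-1 * (X * Y + Xq * Yq + ('i * (X * Yq) - 'i * (Xq * Y)))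
       - ('i ^+ 2 + 1) * ((X + Xq) * (Y + Yq)) / 4); first by field.
    by rewrite sqrCi addNr !mul0r subr0 !mulNr.
  (* With c, a, b for the coefficients at (pp, pp), (pp, qq), (pq, qp), expanding this instance of
     invariance gives (2c + 2a + 2b) / 4 = c, that is, c = a + b. *)
  have := finv _ U (delta_mx p p) (delta_mx p p).
  rewrite VE !(fDl, fDr, fZl, fZr) !fT.
  have qp : q != p by [].
  have z1 : T p p p q = 0 by apply: T_eq0.
  have z2 : T p p q p = 0 by apply: T_eq0.
  have z3 : T q q p q = 0 by apply: T_eq0.
  have z4 : T q q q p = 0 by apply: T_eq0.
  have z5 : T p q p p = 0 by apply: T_eq0.
  have z6 : T p q q q = 0 by apply: T_eq0.
  have z7 : T q p p p = 0 by apply: T_eq0.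
  have z8 : T q p q q = 0 by apply: T_eq0.
  have z9 : T p q p q = 0 by apply: T_eq0.
  have z10 : T q p q p = 0 by apply: T_eq0.
  rewrite z1 z2 z3 z4 z5 z6 z7 z8 z9 z10 (Ta _ _ qp) (Tb _ _ qp) (Tc q).
  move: (T p p p p) (T p p q q) (T p q q p) => c a b fE.
  (* The multiple of 'i ^+ 2 + 1 = 0 turns this into an identity for field. *)
  have /eqP : (2^-1 * c - 2^-1 * (a + b) + ('i ^+ 2 + 1) * b / 2 = 0 :> C).
    by move/eqP: fE; rewrite -subr_eq0 => /eqP fE; rewrite -oppr0 -[in RHS]fE; field.
  rewrite sqrCi addNr !mul0r addr0 subr_eq0 => /eqP; exact: (mulfI (invr_neq0 two0)).
exists (T p p q q), (T p q q p); apply: eq_bilinear_delta => //.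
- by move=> D k B1 B2; rewrite mulmxDl !linearD /= -scalemxAl !linearZ /=; ring.
- by move=> B k D1 D2; rewrite mulmxDr !linearD /= -scalemxAr !linearZ /=; ring.
move=> i j k l; rewrite fT !mxtrace_delta mul_delta_mx_cond raddfMn /= mxtrace_delta.
case: (boolP ((i == j) && (k == l) || (i == l) && (j == k))); last first.
  move=> nz; rewrite T_eq0 //; move: nz; rewrite negb_or !negb_and.
  case: eqP => _; case: eqP => _ //=; case: eqP => _; case: eqP => _ //= _;
  by rewrite ?mulr0 ?mul0r ?mulr0 ?add0r ?mulr0n ?mul0rn ?mulr0.
(* The two surviving index patterns overlap only when all four indices agree; there both traces
   contribute and [Tabc] supplies the sum. *)
case/orP => /andP[/eqP <- /eqP <-]; rewrite !eqxx ?[_ == i]eq_sym.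
  case: (eqVneq i k) => [<-|ik]; first by rewrite Tc Tabc !mulr1.
  by rewrite Ta // mulr0n mulr0 addr0 !mulr1.
case: (eqVneq i j) => [<-|ij]; first by rewrite Tc Tabc !mulr1.
by rewrite Tb // !mulr0 add0r mulr1.
Qed.
End InvariantForm.

Local Open Scope classical_set_scope.
Local Open Scope complex_scope.

Lemma normc_ge_Im (R : rcfType) (x : R[i]) : `|complex.Im x|%:C <= `|x|.
Proof.
by case: x => a b; simpc; rewrite -sqrtr_sqr ler_wsqrtr // lerDr sqr_ge0.
Qed.

(** * Integration of bounded complex-valued functions *)

Section ComplexIntegral.
Context (disp : measure_display) (T : measurableType disp) (R : realType).
Implicit Types h : T -> R[i].

(** Stronger than integrability, but closed under products, so it passes from the entries of [U] to
    any polynomial in them and their conjugates. *)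
Definition bounded_mfun h : Prop :=
  [/\ measurable_fun setT (fun x => complex.Re (h x)),
      measurable_fun setT (fun x => complex.Im (h x)) &
      exists M : R, forall x, `|h x| <= M%:C].

Lemma bounded_mfun_cst (c : R[i]) : bounded_mfun (fun=> c).
Proof.
split; [exact: measurable_cst|exact: measurable_cst|].
by exists (Num.sqrt (complex.Re c ^+ 2 + complex.Im c ^+ 2)) => _; rewrite normc_def.
Qed.

Lemma bounded_mfunD h1 h2 : bounded_mfun h1 -> bounded_mfun h2 ->
  bounded_mfun (fun x => h1 x + h2 x).
Proof.
move=> [r1 i1 [M1 b1]] [r2 i2 [M2 b2]]; split.
- under eq_fun do rewrite raddfD; exact: measurable_funD.
- under eq_fun do rewrite raddfD; exact: measurable_funD.
exists (M1 + M2) => x; rewrite rmorphD.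
exact: le_trans (ler_normD _ _) (lerD (b1 x) (b2 x)).
Qed.

Lemma bounded_mfunM h1 h2 : bounded_mfun h1 -> bounded_mfun h2 ->
  bounded_mfun (fun x => h1 x * h2 x).
Proof.
move=> [r1 i1 [M1 b1]] [r2 i2 [M2 b2]]; split.
- rewrite (_ : (fun x => _) = (fun x => complex.Re (h1 x) * complex.Re (h2 x)
     - complex.Im (h1 x) * complex.Im (h2 x))).
    by apply: measurable_funB; apply: measurable_funM.
  by apply/funext => x; case: (h1 x) (h2 x) => [? ?] [? ?].
- rewrite (_ : (fun x => _) = (fun x => complex.Re (h1 x) * complex.Im (h2 x)
     + complex.Im (h1 x) * complex.Re (h2 x))).
    by apply: measurable_funD; apply: measurable_funM.
  by apply/funext => x; case: (h1 x) (h2 x) => [? ?] [? ?].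
exists (M1 * M2) => x; rewrite rmorphM normrM.
exact: ler_pM.
Qed.

Lemma bounded_mfun_conj h : bounded_mfun h -> bounded_mfun (fun x => Num.conj (h x)).
Proof.
move=> [r1 i1 [M1 b1]]; split.
- rewrite (_ : (fun x => _) = (fun x => complex.Re (h x))) //.
  by apply/funext => x; case: (h x).
- rewrite (_ : (fun x => _) = (fun x => - complex.Im (h x))).
    exact: measurable_funN.
  by apply/funext => x; case: (h x).
by exists M1 => x; rewrite norm_conjC.
Qed.

Lemma bounded_mfun_sum (I : Type) (r : seq I) (P : pred I) (F : I -> T -> R[i]) :
    (forall i, P i -> bounded_mfun (F i)) ->
  bounded_mfun (fun x => \sum_(i <- r | P i) F i x).
Proof.
move=> FP; elim: r => [|i r IH].
  rewrite (_ : (fun x => _) = fun=> 0); first exact: bounded_mfun_cst.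
  by apply/funext => x; rewrite big_nil.
case: (boolP (P i)) => Pi.
  rewrite (_ : (fun x => _) = fun x => F i x + \sum_(j <- r | P j) F j x).
    by apply: bounded_mfunD => //; exact: FP.
  by apply/funext => x; rewrite big_cons Pi.
rewrite (_ : (fun x => _) = fun x => \sum_(j <- r | P j) F j x) //.
by apply/funext => x; rewrite big_cons (negPf Pi).
Qed.

Definition bounded_mmx m n (F : T -> 'M[R[i]]_(m, n)) : Prop :=
  forall i j, bounded_mfun (fun x => F x i j).

Lemma bounded_mmx_cst m n (A : 'M[R[i]]_(m, n)) : bounded_mmx (fun=> A).
Proof. by move=> i j; exact: bounded_mfun_cst. Qed.

Lemma bounded_mmxM m n p (F : T -> 'M[R[i]]_(m, n)) (G : T -> 'M[R[i]]_(n, p)) :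
  bounded_mmx F -> bounded_mmx G -> bounded_mmx (fun x => F x *m G x).
Proof.
move=> bF bG i j; under eq_fun do rewrite mxE.
by apply: bounded_mfun_sum => k _; exact: bounded_mfunM.
Qed.

Lemma bounded_mfun_tr n (F : T -> 'M[R[i]]_n) :
  bounded_mmx F -> bounded_mfun (fun x => \tr (F x)).
Proof. by move=> bF; apply: bounded_mfun_sum => i _; exact: bF. Qed.

Lemma bounded_mfun_integrable (mu : probability T R) h : bounded_mfun h ->
  mu.-integrable setT (fun x => (complex.Re (h x))%:E) /\
  mu.-integrable setT (fun x => (complex.Im (h x))%:E).
Proof.
move=> [rh ih [M bh]].
have mufin : (mu setT < +oo)%E by rewrite probability_setT ltry.
have nh x : `|complex.Re (h x)| <= M /\ `|complex.Im (h x)| <= M.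
  have bx := bh x; split; rewrite -lecR.
    exact: le_trans (normc_ge_Re _) bx.
  exact: le_trans (normc_ge_Im _) bx.
split; apply: measurable_bounded_integrable => //.
- exists M; split; [exact: num_real|move=> N MN x _ /=].
  by apply: le_trans (ltW MN); have [] := nh x.
- exists M; split; [exact: num_real|move=> N MN x _ /=].
  by apply: le_trans (ltW MN); have [] := nh x.
Qed.

Context (mu : probability T R).

Lemma complex_integral_cst (c : R[i]) : complex_integral mu (fun=> c) = c.
Proof.
have int_cst (r : R) : \int[mu]_x r = r.
  rewrite Rintegral_cst // -[RHS]mulr1; congr (_ * _).
  by have /= := congr1 fine (probability_setT mu).
by rewrite /complex_integral !int_cst; case: c.
Qed.

Lemma complex_integralD h1 h2 : bounded_mfun h1 -> bounded_mfun h2 ->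
  complex_integral mu (fun x => h1 x + h2 x) =
  complex_integral mu h1 + complex_integral mu h2.
Proof.
move=> /(bounded_mfun_integrable mu)[r1 i1] /(bounded_mfun_integrable mu)[r2 i2].
rewrite /complex_integral.
under eq_Rintegral do rewrite raddfD /=.
under [X in _ +i* X]eq_Rintegral do rewrite raddfD /=.
by rewrite !RintegralD.
Qed.

Lemma complex_integralZ (c : R[i]) h : bounded_mfun h ->
  complex_integral mu (fun x => c * h x) = c * complex_integral mu h.
Proof.
move=> /(bounded_mfun_integrable mu)[r1 i1]; rewrite /complex_integral.
case: c => a b.
(* Both components of the product are real linear combinations of the components of [h], so
   linearity of the real integral applies. *)
transitivity
  ((\int[mu]_x (a * complex.Re (h x) + (- b) * complex.Im (h x))) +i*
   (\int[mu]_x (a * complex.Im (h x) + b * complex.Re (h x)))).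
  by congr (_ +i* _); apply: eq_Rintegral => x _; rewrite ?mulNr; case: (h x).
have Zint (k : R) (u : T -> R) : mu.-integrable setT (EFin \o u) ->
    mu.-integrable setT (EFin \o (fun x => k * u x)).
  by move=> iu; exact: (integrableZl measurableT k iu).
rewrite !RintegralD ?RintegralZl //; try exact: Zint.
by simpc.
Qed.

Lemma complex_integral_sum (I : Type) (r : seq I) (P : pred I) (F : I -> T -> R[i]) :
    (forall i, P i -> bounded_mfun (F i)) ->
  complex_integral mu (fun x => \sum_(i <- r | P i) F i x) =
  \sum_(i <- r | P i) complex_integral mu (F i).
Proof.
move=> FP; elim: r => [|i r IH].
  rewrite big_nil -[RHS]complex_integral_cst; congr complex_integral.
  by apply/funext => x; rewrite big_nil.
rewrite big_cons -IH; case: ifPn => Pi.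
  rewrite -complex_integralD; [|exact: FP|exact: bounded_mfun_sum].
  by congr complex_integral; apply/funext => x; rewrite big_cons Pi.
by congr complex_integral; apply/funext => x; rewrite big_cons (negPf Pi).
Qed.

End ComplexIntegral.

(** * The Haar integral on the unitary group *)

Section UnitaryTopology.
Context (R : realType) (d : nat).

(** Continuity of the entries: the inclusion into matrices is continuous for the initial topology,
    and so are matrix coordinates. *)
Lemma nbhs_unitary (U : unitary R d) (P : set R[i]^o) i j :
  nbhs ((U : 'M[R[i]^o]_d) i j) P ->
  nbhs U [set V : unitary R d | P ((V : 'M[R[i]^o]_d) i j)].
Proof.
move=> nP.
have c : continuous (fun V : unitary R d => V : 'M[R[i]^o]_d).
  exact: (@initial_continuous (unitary R d) _ _).
apply: (c U [set M : 'M[R[i]^o]_d | P (M i j)]).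
exact: (@coord_continuous R[i]).
Qed.

(** For the initial topology it suffices to check the underlying matrix, whose entries are finite
    linear combinations of the entries of [U]. *)
Lemma continuous_unitary_mul (V : unitary R d) :
  continuous (fun U : unitary R d => (V * U)%g).
Proof.
apply: (@continuous_comp_initial (unitary R d) _ _
   (fun U : unitary R d => U : 'M[R[i]^o]_d)).
move=> U A [P nP PA].
(* A neighbourhood of a matrix contains a box of entrywise neighbourhoods [P i j]; the conditions
   are finitely many, so their intersection is still a neighbourhood. *)
have : nbhs U [set W : unitary R d | forall i j, P i j ((V *m W : 'M[R[i]^o]_d) i j)].
  apply: (@filter_forall _ _ (fun i => [set W : unitary R d |
    forall j, P i j ((V *m W : 'M[R[i]^o]_d) i j)]) (nbhs U)) => i.
  apply: (@filter_forall _ _ (fun j => [set W : unitary R d |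
    P i j ((V *m W : 'M[R[i]^o]_d) i j)]) (nbhs U)) => j.
  have c : (fun W : unitary R d => (V *m W : 'M[R[i]^o]_d) i j) @ U -->
      ((V *m U : 'M[R[i]^o]_d) i j).
    rewrite mxE (_ : (fun W : unitary R d => _) = fun W : unitary R d =>
      \sum_k (V i k : R[i]^o) * ((W : 'M[R[i]^o]_d) k j)); last first.
      by apply/funext => W; rewrite mxE.
    apply: (@cvg_big R[i]^o _ _ 0 xpredT (@add_continuous R[i]^o) _ (nbhs U)
      _ _ _ (nbhs_filter U)) => k _.
    apply: (@cvgMl_tmp R[i] _ (nbhs U) (nbhs_filter U)) => Q; exact: nbhs_unitary.
  exact: c (nP i j).
by apply: filterS => W /PA.
Qed.

Lemma Re_continuous : continuous (fun z : R[i]^o => complex.Re (z : R[i])).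
Proof.
move=> z A /nbhs_ballP[e e0 eA].
apply/nbhs_ballP; exists e%:C; first by rewrite /= ltcR.
move=> w; rewrite /ball /= => zw; apply: eA; rewrite /ball /= -raddfB.
by rewrite -ltcR; exact: le_lt_trans (normc_ge_Re _) zw.
Qed.

Lemma Im_continuous : continuous (fun z : R[i]^o => complex.Im (z : R[i])).
Proof.
move=> z A /nbhs_ballP[e e0 eA].
apply/nbhs_ballP; exists e%:C; first by rewrite /= ltcR.
move=> w; rewrite /ball /= => zw; apply: eA; rewrite /ball /= -raddfB.
by rewrite -ltcR; exact: le_lt_trans (normc_ge_Im _) zw.
Qed.

Lemma continuous_unitary_measurable (f : unitary R d -> R) :
  continuous f -> measurable_fun setT (f : unitary_borel R d -> R).
Proof.
move=> /continuousP cf; apply: (measurability _ (RGenOpens.measurableE R)).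
move=> _ [_ [a [b ->] <-]]; rewrite setTI.
apply: sub_sigma_algebra; exact/cf/interval_open.
Qed.

Lemma measurable_unitary_mul (V : unitary R d) :
  measurable_fun setT (fun U : unitary_borel R d => (V * U)%g : unitary_borel R d).
Proof.
apply: (@measurability _ _ _ (unitary_borel R d) setT _ (@open (unitary R d)) erefl).
move=> _ [A oA <-]; rewrite setTI; apply: sub_sigma_algebra.
by move/continuousP : (@continuous_unitary_mul V); exact.
Qed.

(** Rows of a unitary matrix have norm 1, so the squared modulus of an entry is one of several
    nonnegative terms with sum 1. *)
Lemma normc_unitary_le1 (U : unitary R d) i j : `|U i j| <= 1.
Proof.
rewrite -(@expr_le1 _ 2) //.
have /matrixP/(_ i i) := unitarymxP (unitary_mxP U).
rewrite !mxE eqxx mulr1n => row1; rewrite -[leRHS]row1 (bigD1 j) //= !mxE -normCK lerDl.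
by apply: sumr_ge0 => k _; rewrite !mxE -normCK exprn_ge0.
Qed.

Lemma bounded_mmx_unitary :
  bounded_mmx (fun U : unitary_borel R d => unitary_mx U).
Proof.
move=> i j.
have entry (g : R[i]^o -> R) : continuous g ->
    measurable_fun setT (fun U : unitary_borel R d => g (unitary_mx U i j)).
  move=> cg; apply: continuous_unitary_measurable => U A nA.
  by apply: (@nbhs_unitary U (g @^-1` A)); exact: cg nA.
split; [exact: entry (@Re_continuous)|exact: entry (@Im_continuous)|].
by exists 1 => U; exact: normc_unitary_le1.
Qed.

Lemma bounded_mmx_unitaryV :
  bounded_mmx (fun U : unitary_borel R d => (unitary_mx U)^t*).
Proof.
move=> i j; rewrite (_ : (fun U => _) = fun U : unitary_borel R d => Num.conj (U j i)).
  exact/bounded_mfun_conj/bounded_mmx_unitary.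
by apply/funext => U; rewrite !mxE.
Qed.

(** Change of variables: [is_haar] says that the pushforward of [mu] under translation by [V] agrees
    with [mu] on measurable sets. *)
Lemma haar_integral_mul (mu : probability (unitary_borel R d) R)
    (V : unitary R d) (h : unitary_borel R d -> R[i]) :
  is_haar mu -> bounded_mfun h ->
  complex_integral mu (fun U => h ((V * U)%g : unitary R d)) = complex_integral mu h.
Proof.
move=> mu_haar bh.
pose phi (U : unitary_borel R d) : unitary_borel R d := (V * U)%g.
have mphi : measurable_fun setT phi := measurable_unitary_mul V.
pose phi' : {mfun _ >-> _} := HB.pack phi (isMeasurableFun.Build _ _ _ _ _ mphi).
have bhV : bounded_mfun (h \o phi).
  case: bh => rh ih [M hM]; split; last by exists M => U; exact: hM.
  - exact: (measurableT_comp rh mphi).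
  - exact: (measurableT_comp ih mphi).
have [rV iV] := bounded_mfun_integrable mu bhV.
case: bh => /measurable_EFinP rh /measurable_EFinP ih _.
have inv (u : unitary_borel R d -> R) :
    measurable_fun setT (EFin \o u) -> mu.-integrable setT (EFin \o (u \o phi)) ->
    \int[mu]_U u (phi U) = \int[mu]_U u U.
  move=> mu_ iu; congr fine.
  transitivity (\int[pushforward mu phi']_U (u U)%:E)%E.
    by rewrite (integral_pushforward mphi mu_).
  apply: eq_measure_integral => A mA _; exact: mu_haar.
by congr (_ +i* _); apply: inv.
Qed.
End UnitaryTopology.

(** * The averaged trace as an invariant form in [B] and [D] *)

Section HaarMoment.
Context (R : realType) (d : nat) (mu : probability (unitary_borel R d) R).
Context (A C : 'M[R[i]]_d).
Implicit Types (B D : 'M[R[i]]_d) (U V : unitary R d).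

Lemma unitary_mulVmx U : (unitary_mx U)^t* *m U = 1%:M.
Proof. by apply: mulmx1C; apply/unitarymxP; exact: unitary_mxP. Qed.

(** The integrand of [otoc_haar] without the factor [d%:R^-1], which is put back in the final
    computation. *)
Definition otoc B D U : R[i] :=
  \tr (A *m (U^t* *m B *m U) *m C *m (U^t* *m D *m U)).

Definition otoc_form B D : R[i] := complex_integral mu (otoc B D).

Lemma bounded_mfun_otoc B D : bounded_mfun (otoc B D : unitary_borel R d -> R[i]).
Proof.
apply: bounded_mfun_tr; do !apply: bounded_mmxM;
  by [exact: bounded_mmx_cst|exact: bounded_mmx_unitary|exact: bounded_mmx_unitaryV].
Qed.

Lemma otoc_formDl D : scalar (otoc_form^~ D).
Proof.
move=> k B1 B2; rewrite /otoc_form -complex_integralZ; last exact: bounded_mfun_otoc.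
rewrite -complex_integralD; [|by apply: bounded_mfunM; [exact: bounded_mfun_cst|
  exact: bounded_mfun_otoc]|exact: bounded_mfun_otoc].
congr complex_integral; apply/funext => U; rewrite /otoc.
rewrite !(mulmxDl, mulmxDr) -!(scalemxAl, scalemxAr).
by rewrite mxtraceD mxtraceZ.
Qed.

Lemma otoc_formDr B : scalar (otoc_form B).
Proof.
move=> k B1 B2; rewrite /otoc_form -complex_integralZ; last exact: bounded_mfun_otoc.
rewrite -complex_integralD; [|by apply: bounded_mfunM; [exact: bounded_mfun_cst|
  exact: bounded_mfun_otoc]|exact: bounded_mfun_otoc].
congr complex_integral; apply/funext => U; rewrite /otoc.
rewrite !(mulmxDl, mulmxDr) -!(scalemxAl, scalemxAr).
by rewrite mxtraceD mxtraceZ.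
Qed.

(** Conjugating [B] and [D] by [V] has the same effect on the integrand as replacing [U] by
    [V * U]. *)
Lemma otoc_form_conj (mu_haar : is_haar mu) (V : 'M[R[i]]_d) :
  V \is unitarymx -> forall B D,
  otoc_form (V^t* *m B *m V) (V^t* *m D *m V) = otoc_form B D.
Proof.
move=> Vu B D; rewrite /otoc_form.
rewrite -[RHS](haar_integral_mul (Unitary Vu) mu_haar (bounded_mfun_otoc _ _)).
congr complex_integral; apply/funext => U; rewrite /otoc /= trmx_mul map_mxM.
by rewrite !mulmxA.
Qed.

Lemma otoc_form1 : otoc_form 1%:M 1%:M = \tr (A *m C).
Proof.
rewrite /otoc_form -[RHS](complex_integral_cst mu); congr complex_integral.
by apply/funext => U; rewrite /otoc !mulmx1 !unitary_mulVmx !mulmx1.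
Qed.

(** For every [U], reassociating places [U *m C *m U^t*] between the two units. Their sum is the
    scalar matrix of its trace, which is [\tr C]; the outer factors [U^t*] and [U] then cancel and
    leave [\tr A]. *)
Lemma sum_otoc_form_delta :
  \sum_i \sum_j otoc_form (delta_mx i j) (delta_mx j i) = \tr A * \tr C.
Proof.
rewrite /otoc_form.
rewrite pair_bigA /= -complex_integral_sum; last by move=> p _; exact: bounded_mfun_otoc.
rewrite -[RHS](complex_integral_cst mu); congr complex_integral; apply/funext => U.
rewrite -(pair_bigA _ (fun i j => otoc (delta_mx i j) (delta_mx j i) U)) /=.
transitivity (\tr (A *m U^t* *m (\sum_i \sum_j
   delta_mx i j *m (U *m C *m U^t*) *m delta_mx j i) *m U)).
  rewrite mulmx_sumr mulmx_suml raddf_sum; apply: eq_bigr => i _.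
  rewrite mulmx_sumr mulmx_suml raddf_sum; apply: eq_bigr => j _.
  by rewrite /otoc; congr (\tr _); rewrite !mulmxA.
rewrite sum_delta_mul_delta mul_mx_scalar -scalemxAl mxtraceZ.
rewrite -(mulmxA A) unitary_mulVmx mulmx1 mxtrace_mulC mulmxA unitary_mulVmx mul1mx.
by rewrite mulrC.
Qed.

End HaarMoment.

(** * The two coefficients and the closed formula *)

Theorem mainTheorem6 (R : realType) (n : nat) (n_ge1 : (1 <= n)%N)
    (mu : probability (unitary_borel R (2 ^ n)) R) (mu_haar : is_haar mu)
    (A B C D : 'M[R[i]]_(2 ^ n)) :
  otoc_haar mu A B C D =
    mean (A *m C) * mean B * mean D + mean A * mean C * mean (B *m D)
    - mean A * mean C * mean B * mean D
    - ((2 ^ n)%N%:R ^+ 2 - 1)^-1 * connected_corr A C * connected_corr B D.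
Proof.
have d1 : (1 < 2 ^ n)%N by rewrite -{1}(expn0 2) ltn_exp2l.
(* The dimension enters only through [1 < d], which yields the classification of the form and also
   d^2 - 1 != 0. *)
move: d1 mu mu_haar A B C D; move: (2 ^ n)%N => d d1 mu mu_haar A B C D.
have [a [b fE]] := unitary_invariant_form d1 (otoc_formDl mu A C)
  (otoc_formDr mu A C) (otoc_form_conj A C mu_haar).
have -> : otoc_haar mu A B C D = d%:R^-1 * otoc_form mu A C B D.
  by rewrite -complex_integralZ //; exact: bounded_mfun_otoc.
have := otoc_form1 mu A C; rewrite fE mulmx1 !mxtrace1 => AC.
have AtC : a * d%:R + b * d%:R ^+ 2 = \tr A * \tr C.
  rewrite -(sum_otoc_form_delta mu A C).
  (* The form at E_ij, E_ji equals b, plus a when i = j; summing over j gives a + b d for each i. *)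
  transitivity (\sum_(i < d) (a + b * d%:R)).
    by rewrite sumr_const card_ord -mulr_natr; ring.
  apply: eq_bigr => i _; transitivity (\sum_(j < d) (a * (i == j)%:R + b)).
    rewrite mulr_natr big_split /= -mulr_sumr sumr_const card_ord.
    rewrite (bigD1 i) //= eqxx big1 ?addr0 ?mulr1 // => j.
    by rewrite eq_sym => /negPf ->.
  apply: eq_bigr => j _; rewrite fE mul_delta_mx !mxtrace_delta eqxx mulr1.
  by rewrite [j == i]eq_sym -natrM mulnb andbb.
have d0 : d%:R != 0 :> R[i] by rewrite pnatr_eq0 -lt0n ltnW.
have d2 : d%:R ^+ 2 - 1 != 0 :> R[i].
  by rewrite subr_eq0 -natrX pnatr_eq1 -(exp1n 2) eqn_exp2r // gtn_eqF.
rewrite fE /connected_corr /mean.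
set x := d%:R in d0 d2 AC AtC *.
(* Regrouping makes [\tr A * \tr C] appear literally, so that [AC] and [AtC] can replace it and
   [\tr (A *m C)] by expressions in a, b and x; the rest is an identity of rational functions. *)
transitivity (x^-1 * \tr (A *m C) * (x^-1 * \tr B) * (x^-1 * \tr D)
  + x^-1 ^+ 2 * (\tr A * \tr C) * (x^-1 * \tr (B *m D))
  - x^-1 ^+ 2 * (\tr A * \tr C) * (x^-1 * \tr B) * (x^-1 * \tr D)
  - (x ^+ 2 - 1)^-1 * (x^-1 * \tr (A *m C) - x^-1 ^+ 2 * (\tr A * \tr C))
    * (x^-1 * \tr (B *m D) - x^-1 * \tr B * (x^-1 * \tr D))); last by ring.
rewrite -AC -AtC.
by field; rewrite d0 d2.
Qed.
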